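(* Let $(C,A)\in\widetilde{\mathcal S}_{-1}^{\,p\times N}\times\widetilde{\mathcal S}_{-1}^{\,N\times N}$ ($p,N\ge1$). If the pair $(E[C],E[A])\in\mathbb C^{p\times N}\times\mathbb C^{N\times N}$ is observable (over $\mathbb C$), then the pair $(C,A)$ is observable (over $\widetilde{\mathcal S}_{-1}$).
   Context: $\mathbb N=\{1,2,\dots\}$. $\widetilde\ell$ is the free (non-commutative) monoid generated by symbols $z_1,z_2,\dots$, with identity the empty word. For $\alpha=z_{i_1}\cdots z_{i_m}\in\widetilde\ell$ put $(2\mathbb N)^\alpha=\prod_{k=1}^m(2i_k)$ (empty product $=1$). $\widetilde{\mathcal S}_{-1}$ is the set of formal sums $f=\sum_{\alpha\in\widetilde\ell}f_\alpha e_\alpha$, $f_\alpha\in\mathbb C$, such that $\sum_\alpha|f_\alpha|^2((2\mathbb N)^{\alpha})^{-r}<\infty$ for some $r\in\mathbb N$; it is a unital $\mathbb C$-algebra under the Wick product $f\otimes g=\sum_{\gamma\in\widetilde\ell}\big(\sum_{\alpha\beta=\gamma}f_\alpha g_\beta\big)e_\gamma$, with unit $\mathbf 1=e_{\text{empty word}}$. Matrices over $\widetilde{\mathcal S}_{-1}$ are multiplied using this product. The generalized expectation $E[f]\in\mathbb C$ is the coefficient of $f$ at the empty word, and $E$ is applied to matrices entrywise. For a unital associative ring $R$, a pair $(C,A)\in R^{p\times N}\times R^{N\times N}$ is called observable if there exists an integer $q\ge1$ such that the block column matrix $$\begin{pmatrix}C\\ CA\\ CA^2\\ \vdots\\ CA^{q-1}\end{pmatrix}\in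 R^{pq\times N}$$ is left invertible, i.e. has a left inverse in $R^{N\times pq}$. *)

(* Defs.v *)
From HB Require Import structures.
From mathcomp Require Import all_boot all_order all_algebra.
From mathcomp Require Import all_classical all_reals all_analysis.
From mathcomp Require Import complex.
From mathcomp Require Import ring lra.

Set Implicit Arguments.
Unset Strict Implicit.
Unset Printing Implicit Defensive.

Import Order.TTheory GRing.Theory Num.Theory.
Import ComplexField.Normc.

Local Open Scope classical_set_scope.
Local Open Scope ring_scope.

(* A word z_{i_1} ... z_{i_m} of the free monoid is the sequence of the shifted
   indices [:: i_1 - 1; ...; i_m - 1], so that all of [nat] is used and the
   letter [k : nat] stands for z_{k+1}, of weight 2 * (k + 1). *)
Notation word := (seq nat) (only parsing).

Definition weight (a : word) : nat := \prod_(k <- a) (2 * k.+1)%N.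

(* [ncseries R]: all formal sums of the f_a e_a over words [a], as functions
   a |-> f_a.  It is kept as an alias because the ring structure is given by
   the Wick product and not by the pointwise product of functions. *)
Definition ncseries (R : realType) : Type := word -> R[i].

HB.instance Definition _ (R : realType) :=
  GRing.Zmodule.copy (ncseries R) (word -> R[i]).

Section Wick.
Variable R : realType.
Implicit Types (f g h : ncseries R) (a b c : word).

(* The factorizations a b = c are c = (take i c) (drop i c) for i = 0..|c|. *)
Definition wick f g : ncseries R :=
  fun c => \sum_(i < (size c).+1) f (take i c) * g (drop i c).

Definition wick1 : ncseries R := fun c => (c == [::])%:R.

Definition wick_scale (k : R[i]) f : ncseries R := fun c => k * f c.

Let shift (x : nat) f : ncseries R := fun c => f (x :: c).

Lemma ncseriesD f g c : (f + g) c = f c + g c.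
Proof. by []. Qed.

Lemma wick_nil f g : wick f g [::] = f [::] * g [::].
Proof. by rewrite /wick big_ord_recl big_ord0 addr0. Qed.

Lemma wick_cons f g x c :
  wick f g (x :: c) = f [::] * g (x :: c) + wick (shift x f) g c.
Proof. by rewrite /wick big_ord_recl. Qed.

Lemma wickDl : left_distributive wick +%R.
Proof.
move=> f g h; apply/funext => c; rewrite ncseriesD /wick -big_split /=.
by apply: eq_bigr => i _; rewrite mulrDl.
Qed.

Lemma wickDr : right_distributive wick +%R.
Proof.
move=> f g h; apply/funext => c; rewrite ncseriesD /wick -big_split /=.
by apply: eq_bigr => i _; rewrite mulrDr.
Qed.

Lemma wickZl k f g : wick (wick_scale k f) g = wick_scale k (wick f g).
Proof.
apply/funext => c; rewrite /wick /wick_scale mulr_sumr.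
by apply: eq_bigr => i _; rewrite mulrA.
Qed.

Lemma wickZr k f g : wick f (wick_scale k g) = wick_scale k (wick f g).
Proof.
apply/funext => c; rewrite /wick /wick_scale mulr_sumr.
by apply: eq_bigr => i _; rewrite mulrCA.
Qed.

Lemma shift_wick x f g :
  shift x (wick f g) = wick_scale (f [::]) (shift x g) + wick (shift x f) g.
Proof. by apply/funext => c; rewrite /shift wick_cons. Qed.

Lemma wickA : associative wick.
Proof.
move=> f g h; apply/funext => c.
elim: c f g h => [|x c IH] f g h; first by rewrite !wick_nil mulrA.
rewrite !wick_cons shift_wick wickDl wickZl ncseriesD -IH wick_nil.
by rewrite /wick_scale mulrDr !mulrA addrA.
Qed.

Lemma wick1l : left_id wick1 wick.
Proof.
move=> f; apply/funext => c; case: c => [|x c].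
  by rewrite wick_nil mul1r.
by rewrite wick_cons mul1r /wick big1 ?addr0// => i _; rewrite mul0r.
Qed.

Lemma wick1r : right_id wick1 wick.
Proof.
move=> f; apply/funext => c; elim: c f => [|x c IH] f.
  by rewrite wick_nil mulr1.
by rewrite wick_cons mulr0 add0r IH.
Qed.

Lemma wick1_neq0 : wick1 != 0.
Proof.
apply/eqP => /(congr1 (fun f : ncseries R => f [::])) /eqP.
by rewrite oner_eq0.
Qed.

HB.instance Definition _ := GRing.Zmodule_isNzRing.Build (ncseries R)
  wickA wick1l wick1r wickDl wickDr wick1_neq0.

Lemma wick_scaleA k l f :
  wick_scale k (wick_scale l f) = wick_scale (k * l) f.
Proof. by apply/funext => c; rewrite /wick_scale mulrA. Qed.

Lemma wick_scale1 : left_id 1 wick_scale.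
Proof. by move=> f; apply/funext => c; rewrite /wick_scale mul1r. Qed.

Lemma wick_scaleDr : right_distributive wick_scale +%R.
Proof. by move=> k f g; apply/funext => c; rewrite /wick_scale mulrDr. Qed.

Lemma wick_scaleDl f : {morph wick_scale^~ f : k l / k + l}.
Proof. by move=> k l; apply/funext => c; rewrite /wick_scale mulrDl. Qed.

HB.instance Definition _ := GRing.Zmodule_isLmodule.Build R[i] (ncseries R)
  wick_scaleA wick_scale1 wick_scaleDr wick_scaleDl.

Lemma ncseries_scalerAl (k : R[i]) f g : k *: (f * g) = k *: f * g.
Proof. exact: esym (wickZl k f g). Qed.

HB.instance Definition _ :=
  GRing.Lmodule_isLalgebra.Build R[i] (ncseries R) ncseries_scalerAl.

Lemma ncseries_scalerAr (k : R[i]) f g : k *: (f * g) = f * (k *: g).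
Proof. exact: esym (wickZr k f g). Qed.

HB.instance Definition _ :=
  GRing.Lalgebra_isAlgebra.Build R[i] (ncseries R) ncseries_scalerAr.

Definition sqnorm_term (r : nat) f a : R :=
  normc (f a) ^+ 2 / (weight a)%:R ^+ r.

(* The sum of the |f_a|^2 ((2N)^a)^{-r} over all words, in [0, +oo]. *)
Definition sqnorm (r : nat) f : \bar R :=
  (\esum_(a in [set: word]) (sqnorm_term r f a)%:E)%E.

Arguments sqnorm r%_N f%_R.

Definition s_minus1 : {pred ncseries R} :=
  fun f => `[< exists2 r : nat, (0 < r)%N & (sqnorm r f < +oo)%E >].

Lemma weight_cat a b : weight (a ++ b) = (weight a * weight b)%N.
Proof. by rewrite /weight big_cat. Qed.

Lemma weight_ge a : (2 ^ size a <= weight a)%N.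
Proof.
elim: a => [|k a IH]; first by rewrite /weight big_nil.
rewrite /weight big_cons /= expnS leq_mul//.
by rewrite -[X in (X <= _)%N]muln1 leq_mul.
Qed.

Lemma weight_gt0 a : (0 < weight a)%N.
Proof. by apply: leq_trans (weight_ge a); rewrite expn_gt0. Qed.

Lemma weight_ge1 a : 1 <= (weight a)%:R :> R.
Proof. by rewrite ler1n weight_gt0. Qed.

Lemma normc_ge0 (x : R[i]) : 0 <= normc x.
Proof. by case: x => u v /=; rewrite sqrtr_ge0. Qed.

Lemma sqnorm_term_ge0 r f a : 0 <= sqnorm_term r f a.
Proof. by rewrite /sqnorm_term divr_ge0 ?sqr_ge0// exprn_ge0. Qed.

Lemma le_sqnorm r s f : (r <= s)%N -> (sqnorm s f <= sqnorm r f)%E.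
Proof.
move=> rs; apply: le_esum => a _; rewrite lee_fin /sqnorm_term.
rewrite ler_wpM2l ?sqr_ge0// lef_pV2 ?posrE ?exprn_gt0 ?ltr0n ?weight_gt0//.
by rewrite ler_weXn2l ?weight_ge1.
Qed.

Lemma esumZ_le (T : choiceType) (k : R) (u : T -> R) :
  0 <= k -> (forall t, 0 <= u t) ->
  (\esum_(t in [set: T]) (k * u t)%:E
     <= k%:E * \esum_(t in [set: T]) (u t)%:E)%E.
Proof.
move=> k0 u0; apply: ge_ereal_sup => _ [X [finX XT]] <-.
rewrite (eq_fsbigr (fun t => k%:E * (u t)%:E)%E); last first.
  by move=> t _; rewrite EFinM.
rewrite -ge0_mule_fsumr; last by move=> t; rewrite lee_fin.
rewrite lee_wpmul2l ?lee_fin//.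
by apply: ereal_sup_ubound; exists X.
Qed.

Lemma normcD_sqr (x y : R[i]) :
  normc (x + y) ^+ 2 <= 2 * (normc x ^+ 2 + normc y ^+ 2).
Proof.
have h : normc (x + y) ^+ 2 <= (normc x + normc y) ^+ 2.
  by rewrite ler_sqr ?nnegrE ?addr_ge0 ?normc_ge0// le_normcD.
apply: (le_trans h).
have := sqr_ge0 (normc x - normc y); nra.
Qed.

Lemma normc_sum_sqr n (x : 'I_n -> R[i]) :
  normc (\sum_(i < n) x i) ^+ 2 <= 2 ^+ n * \sum_(i < n) normc (x i) ^+ 2.
Proof.
elim: n x => [|n IH] x; first by rewrite !big_ord0 normc0 expr0n /= mulr0.
rewrite !big_ord_recl; apply: (le_trans (normcD_sqr _ _)).
rewrite (exprS 2 n) -mulrA ler_pM2l// mulrDr lerD//.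
by rewrite ler_peMl ?sqr_ge0// exprn_ege1// ler1n.
Qed.

Lemma sqnormD r f g :
  (sqnorm r f < +oo)%E -> (sqnorm r g < +oo)%E -> (sqnorm r (f + g) < +oo)%E.
Proof.
move=> hf hg.
have : (sqnorm r (f + g) <= 2%:E * (sqnorm r f + sqnorm r g))%E.
  rewrite /sqnorm -esumD; try by move=> a _; rewrite lee_fin sqnorm_term_ge0.
  apply: le_trans (esumZ_le (u := fun a => sqnorm_term r f a + sqnorm_term r g a)
    _ _) => //; last by move=> a; rewrite addr_ge0 ?sqnorm_term_ge0.
  apply: le_esum => a _; rewrite lee_fin /sqnorm_term -mulrDl mulrA.
  by rewrite ler_wpM2r ?normcD_sqr// invr_ge0 exprn_ge0.
by move/le_lt_trans; apply; rewrite lte_mul_pinfty ?lte_add_pinfty.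
Qed.

Lemma sqnormZ r k f : (sqnorm r f < +oo)%E -> (sqnorm r (k *: f) < +oo)%E.
Proof.
move=> hf.
have : (sqnorm r (k *: f) <= (normc k ^+ 2)%:E * sqnorm r f)%E.
  apply: le_trans (esumZ_le (sqr_ge0 _) (sqnorm_term_ge0 r f)).
  by apply: le_esum => a _; rewrite lee_fin /sqnorm_term normcM exprMn -mulrA.
by move/le_lt_trans; apply; rewrite lte_mul_pinfty ?lee_fin ?sqr_ge0.
Qed.

Lemma sqnorm_term_wick r f g c :
  sqnorm_term r.+1 (wick f g) c <=
  2 * \sum_(i < (size c).+1)
        sqnorm_term r f (take i c) * sqnorm_term r g (drop i c).
Proof.
have wc0 : 0 < (weight c)%:R :> R by rewrite ltr0n weight_gt0.
rewrite {1}/sqnorm_term ler_pdivrMr ?exprn_gt0//.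
apply: (le_trans (normc_sum_sqr _)).
have -> : \sum_(i < (size c).+1) normc (f (take i c) * g (drop i c)) ^+ 2 =
    (\sum_(i < (size c).+1)
       sqnorm_term r f (take i c) * sqnorm_term r g (drop i c))
      * (weight c)%:R ^+ r.
  rewrite mulr_suml; apply: eq_bigr => i _.
  rewrite -[in (weight c)%:R](cat_take_drop i c) weight_cat natrM exprMn.
  rewrite /sqnorm_term normcM exprMn.
  have := weight_gt0 (take i c); have := weight_gt0 (drop i c).
  by rewrite -!(ltr0n R) => h1 h2; field; rewrite !expf_neq0 ?gt_eqF.
rewrite [_ ^+ r.+1]exprS [X in X <= _]mulrC exprS.
rewrite [X in X <= _](_ : _ = 2 * (\sum_(i < (size c).+1)
       sqnorm_term r f (take i c) * sqnorm_term r g (drop i c))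
      * (2 ^+ size c * (weight c)%:R ^+ r)); last by ring.
rewrite ler_wpM2l// ?mulr_ge0 ?sumr_ge0// => [i _|].
  by rewrite mulr_ge0 ?sqnorm_term_ge0.
by rewrite ler_wpM2r ?exprn_ge0// -natrX ler_nat weight_ge.
Qed.

Lemma esum_factor_fin (u v : word -> R) :
  (forall a, 0 <= u a) -> (forall a, 0 <= v a) ->
  (\esum_(a in [set: word]) (u a)%:E < +oo)%E ->
  (\esum_(b in [set: word]) (v b)%:E < +oo)%E ->
  (\esum_(c in [set: word])
     (\sum_(i < (size c).+1) u (take i c) * v (drop i c))%:E < +oo)%E.
Proof.
move=> u0 v0.
set U := (\esum_(a in _) _)%E; set V := (\esum_(b in [set: word]) _)%E.
move=> Ufin Vfin.
have Vge0 : (0 <= V)%E by apply: esum_ge0 => b _; rewrite lee_fin.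
have VE : V = (fine V)%:E by rewrite fineK// ge0_fin_numE.
have v'0 : 0 <= fine V by rewrite fine_ge0.
pose J (c : word) := `I_(size c).+1.
pose e (k : word * nat) : word * word := (take k.2 k.1, drop k.2 k.1).
pose w (ab : word * word) : \bar R := (u ab.1 * v ab.2)%:E.
have w0 ab : (0 <= w ab)%E by rewrite lee_fin mulr_ge0.
have -> : (\esum_(c in [set: word])
     (\sum_(i < (size c).+1) u (take i c) * v (drop i c))%:E =
   \esum_(c in [set: word]) \esum_(i in J c) w (e (c, i)))%E.
  apply: eq_esum => c _; rewrite esum_fset//; last exact: finite_II.
  by rewrite -fsbig_ord sumEFin.
rewrite (esum_esum (a := fun c i => w (e (c, i))))//.
have -> : (\esum_(k in [set: word] `*`` J) w (e (k.1, k.2)) =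
   \esum_(ab in e @` ([set: word] `*`` J)) w ab)%E.
  rewrite esum_image; first by apply: eq_esum => -[].
  move=> [c i] [d j] /set_mem[_ /= ci] /set_mem[_ /= dj] [h1 h2].
  have cd : c = d by rewrite -(cat_take_drop i c) h1 h2 cat_take_drop.
  move: ci dj h1; rewrite cd /J /= !ltnS => ci dj /(congr1 size).
  by rewrite !size_takel// => ->.
apply: (@le_lt_trans _ _
  (\esum_(ab in [set: word] `*`` (fun=> [set: word])) w ab)%E).
  apply: ereal_sup_le => _ [X [finX _] <-]; exists X => //.
rewrite -(esum_esum (a := fun a b => w (a, b)))//.
apply: (@le_lt_trans _ _ (fine V * fine U)%:E); last exact: ltry.
have Uge0 : (0 <= U)%E by apply: esum_ge0 => b _; rewrite lee_fin.
have UE : U = (fine U)%:E by rewrite fineK// ge0_fin_numE.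
rewrite EFinM -UE.
apply: le_trans (esumZ_le v'0 u0); apply: le_esum => a _.
by rewrite mulrC EFinM -VE; exact: (esumZ_le (u0 a) v0).
Qed.

Lemma sqnormM r f g :
  (sqnorm r f < +oo)%E -> (sqnorm r g < +oo)%E ->
  (sqnorm r.+1 (f * g) < +oo)%E.
Proof.
move=> hf hg.
have h := esum_factor_fin (sqnorm_term_ge0 r f) (sqnorm_term_ge0 r g) hf hg.
apply: le_lt_trans (lte_mul_pinfty _ _ h : (2%:E * _ < +oo)%E) => //.
apply: le_trans (esumZ_le _ _) => //.
  by apply: le_esum => c _; rewrite lee_fin; exact: sqnorm_term_wick.
by move=> c; apply: sumr_ge0 => i _; rewrite mulr_ge0 ?sqnorm_term_ge0.
Qed.

Lemma sqnorm1 : (sqnorm 1 (1 : ncseries R) < +oo)%E.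
Proof.
rewrite /sqnorm (esumID [set [::]])//; last first.
  by move=> a _; rewrite lee_fin sqnorm_term_ge0.
rewrite setTI esum_set1 ?lee_fin ?sqnorm_term_ge0// esum1 ?adde0 ?ltry//.
move=> a [_ /= /eqP a0]; rewrite /sqnorm_term.
rewrite (_ : (1 : ncseries R) a = 0); first by rewrite normc0 expr0n /= mul0r.
by rewrite -[LHS]/((a == [::])%:R) (negbTE a0).
Qed.

Lemma s_minus1_subalg : subalg_closed s_minus1.
Proof.
have common f g : f \in s_minus1 -> g \in s_minus1 ->
    exists r : nat, [/\ (0 < r)%N, (sqnorm r f < +oo)%E & (sqnorm r g < +oo)%E].
  move=> /asboolP[r r0 hr] /asboolP[s s0 hs]; exists (maxn r s); split.
  - by rewrite leq_max r0.
  - by apply: le_lt_trans hr; rewrite le_sqnorm// leq_maxl.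
  - by apply: le_lt_trans hs; rewrite le_sqnorm// leq_maxr.
split; first by apply/asboolP; exists 1%N => //; exact: sqnorm1.
- move=> k f g /common h /h[r [r0 hf hg]]; apply/asboolP; exists r => //.
  by apply: sqnormD => //; apply: sqnormZ.
- move=> f g /common h /h[r [r0 hf hg]]; apply/asboolP; exists r.+1 => //.
  exact: sqnormM.
Qed.

HB.instance Definition _ :=
  GRing.isSubalgClosed.Build R[i] (ncseries R) s_minus1 s_minus1_subalg.

Record S_minus1 : Type := MkS_minus1 {
  coefs :> ncseries R;
  coefs_s_minus1 : coefs \in s_minus1
}.

HB.instance Definition _ := [isSub for coefs].
HB.instance Definition _ := [Choice of S_minus1 by <:].
HB.instance Definition _ := [SubChoice_isSubAlgebra of S_minus1 by <:].

(* The generalized expectation E. *)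
Definition gexp (f : S_minus1) : R[i] := coefs f [::].

End Wick.

Section Observability.
Variable R : pzRingType.

Definition obs_mx (p N q : nat) (C : 'M[R]_(p, N)) (A : 'M[R]_N) :
    'M[R]_(\sum_(k < q) p, N) :=
  \mxcol_(k < q) (C *m A ^+ k).

Definition left_invertible (m n : nat) (M : 'M[R]_(m, n)) : Prop :=
  exists L : 'M[R]_(n, m), L *m M = 1%:M.

Definition observable (p N : nat) (C : 'M[R]_(p, N)) (A : 'M[R]_N) : Prop :=
  exists2 q : nat, (0 < q)%N & left_invertible (obs_mx q C A).

End Observability.

(* Main.v *)
Require Import Defs.
From HB Require Import structures.
From mathcomp Require Import all_boot all_order all_algebra.
From mathcomp Require Import all_classical all_reals all_analysis.
From mathcomp Require Import complex.
From mathcomp Require Import ring lra.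

(** Idea of the proof.  A left inverse of the observability matrix of
    (E[C], E[A]), read as a matrix of constant series, multiplies the
    observability matrix of (C, A) to a square matrix M with E[M] = 1, because
    E is a ring morphism.  It remains to see that such an M is left invertible
    ([left_invertible_of_gexp1]); then the same length q works for (C, A).

    For a 1 x 1 matrix this says that a series f = 1 - h with h of zero
    expectation has a left inverse ([s_minus1_left_inverse]).  The Neumann sum
    of the powers of h is a finite sum at each word, since h^n vanishes on the
    words of fewer than n letters, so it always defines a formal inverse; the
    point is that this inverse satisfies the growth condition.  To this end the
    Hilbert norms are traded for pointwise bounds: up to the value at the empty
    word, f belongs to the algebra if and only if |f_a| <= (weight a)^s for
    some s and all a ([s_minus1_of_growth], [growth_of_s_minus1]).
    - One direction rests on the convergence of the sum of (weight a)^-2 over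
      all words ([esum_words_le]), a geometric series of ratio
      (1/4)(1 + 1/4 + 1/9 + ...) <= 1/2.
    - The other one bounds a term by the sum, and absorbs the constant in a
      power of the weight, which is at least 2 on nonempty words.
    A pointwise bound survives inversion: the weight is multiplicative, so each
    product of values of h along a splitting of the word c into nonempty
    factors is at most (weight c)^s, and there are at most 2^|c| <= weight c
    such splittings.

    For larger matrices the upper left entry is left invertible, and
    elimination of the first column leaves a Schur complement which again has
    expectation 1, so that one concludes by induction on the size. *)

Set Implicit Arguments.
Unset Strict Implicit.
Unset Printing Implicit Defensive.

Import Order.TTheory GRing.Theory Num.Theory.
Import ComplexField.Normc.

Local Open Scope classical_set_scope.
Local Open Scope ring_scope.

(** * Pointwise growth bounds *)

Section Growth.
Variable R : realType.
Implicit Types (f g h : ncseries R) (a b c : seq nat).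

(** Each term is at most (1/(k+1) - 1/(k+2)) / 2, and these telescope. *)
Lemma sum_inv_sqr_even n : \sum_(k < n) ((2 * k.+1)%:R ^+ 2)^-1 <= 2^-1 :> R.
Proof.
suff: \sum_(k < n) ((2 * k.+1)%:R ^+ 2)^-1 <= 2^-1 * (1 - n.+1%:R^-1) :> R.
  by move=> /le_trans; apply; rewrite ler_piMr// gerBl.
elim: n => [|n IH]; first by rewrite big_ord0 invr1 subrr mulr0.
rewrite big_ord_recr /=; apply: (le_trans (lerD IH (lexx _))).
have n0 : 0 <= n%:R :> R by [].
rewrite natrM -[n.+2%:R]natr1 -[n.+1%:R]natr1; move: (n%:R) n0 => x x0.
rewrite -subr_ge0.
have -> : 2^-1 * (1 - (x + 1 + 1)^-1) -
    (2^-1 * (1 - (x + 1)^-1) + ((2 * (x + 1)) ^+ 2)^-1)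
  = x / (4 * (x + 1) ^+ 2 * (x + 2)) :> R.
  by field; rewrite !gt_eqF//; lra.
by rewrite divr_ge0// !mulr_ge0// ?exprn_ge0//; lra.
Qed.

Lemma esum_inv_sqr_even :
  (\esum_(k in [set: nat]) (((2 * k.+1)%:R ^+ 2)^-1)%:E <= (2^-1 : R)%:E)%E.
Proof.
have t0 (k : nat) : (0 <= (((2 * k.+1)%:R ^+ 2)^-1 : R)%:E)%E.
  by rewrite lee_fin invr_ge0 exprn_ge0.
rewrite -nneseries_esumT//.
apply: lime_le; first by apply: is_cvg_nneseries => n _ _.
by apply: nearW => n; rewrite /= big_mkord sumEFin lee_fin sum_inv_sqr_even.
Qed.

(** Induction on the length: the sum over the nonempty words x :: a factors
    into a sum over the letter x, at most 1/2, and a sum over shorter words a,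
    at most 2; the empty word adds 1, and 1/2 * 2 + 1 = 2. *)
Lemma esum_short_words_le m :
  (\esum_(a in [set: seq nat])
     (if (size a <= m)%N then ((weight a)%:R ^+ 2)^-1 else 0 : R)%:E
   <= 2%:E)%E.
Proof.
pose v m a : R := if (size a <= m)%N then ((weight a)%:R ^+ 2)^-1 else 0.
have v0 n a : 0 <= v n a.
  by rewrite /v; case: ifP => // _; rewrite invr_ge0 exprn_ge0.
have v0E n a : (0 <= (v n a)%:E)%E by rewrite lee_fin.
have vnil n : v n [::] = 1 by rewrite /v /weight big_nil expr1n invr1.
rewrite -[X in (X <= _)%E]/(\esum_(a in [set: seq nat]) (v m a)%:E)%E.
rewrite (esumID [set [::]])// setTI esum_set1// vnil.
(* It is the sum without the empty word that the induction controls. *)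
suff h : (\esum_(a in [set: seq nat] `&` ~` [set [::]]) (v m a)%:E <= 1)%E.
  by apply: (le_trans (leeD (lexx _) h)); rewrite -EFinD lee_fin; lra.
elim: m => [|m IH].
  rewrite esum1// => a [_ /= a0]; rewrite /v; case: ifP => //.
  by rewrite leqn0 size_eq0 => /eqP.
pose e (ka : nat * seq nat) := ka.1 :: ka.2.
have -> : [set: seq nat] `&` ~` [set [::]] =
    e @` ([set: nat] `*`` (fun=> [set: seq nat])).
  apply/seteqP; split=> [[|k a] [_ //=] _|_ [[k a] _ <-]]; last by split.
  by exists (k, a).
rewrite esum_image; last by move=> [k a] [l b] _ _ [-> ->].
have vS k a : v m.+1 (k :: a) = ((2 * k.+1)%:R ^+ 2)^-1 * v m a.
  rewrite /v /= ltnS; case: ifP => _; last by rewrite mulr0.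
  by rewrite /weight big_cons natrM exprMn invfM.
rewrite (eq_esum
  (b := fun ka => (((2 * ka.1.+1)%:R ^+ 2)^-1 * v m ka.2)%:E)); last first.
  by move=> [k a] _ /=; rewrite /e /= vS.
rewrite -(esum_esum
  (a := fun k a => (((2 * k.+1)%:R ^+ 2)^-1 * v m a)%:E)); last first.
  by move=> k a _ _; rewrite lee_fin mulr_ge0// invr_ge0 exprn_ge0.
have vm2 : (\esum_(a in [set: seq nat]) (v m a)%:E <= 2%:E)%E.
  rewrite (esumID [set [::]])// setTI esum_set1// vnil.
  by apply: (le_trans (leeD (lexx _) IH)); rewrite -EFinD lee_fin; lra.
have k0 (k : nat) : 0 <= ((2 * k.+1)%:R ^+ 2)^-1 :> R.
  by rewrite invr_ge0 exprn_ge0.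
apply: (@le_trans _ _
  (\esum_(k in [set: nat]) (2 * ((2 * k.+1)%:R ^+ 2)^-1 : R)%:E)%E).
  apply: le_esum => k _; apply: (le_trans (esumZ_le (k0 k) (v0 m))).
  by rewrite [X in (_ <= X%:E)%E]mulrC EFinM lee_wpmul2l// lee_fin.
apply: (le_trans (esumZ_le _ k0)) => //.
apply: (le_trans (lee_wpmul2l _ esum_inv_sqr_even)); first by rewrite lee_fin.
by rewrite -EFinM lee_fin mulfV.
Qed.

Lemma esum_words_le :
  (\esum_(a in [set: seq nat]) (((weight a)%:R ^+ 2)^-1 : R)%:E <= 2%:E)%E.
Proof.
apply: ge_ereal_sup => _ [X [finX _] <-].
have [m Xm] : exists m, forall a, X a -> (size a <= m)%N.
  have [r Xr] := (finite_seqP X).1 finX.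
  exists (\max_(a <- r) size a)%N => a; rewrite Xr => ar.
  exact: leq_bigmax_seq.
apply: le_trans (esum_short_words_le m).
apply: esum_ge; exists X => //; rewrite le_eqVlt; apply/orP; left; apply/eqP.
by apply: eq_fsbigr => a /set_mem/Xm ->.
Qed.

Lemma normr_normc (z : R[i]) : `|z| = (normc z)%:C%C.
Proof. by rewrite normc_def; case: z. Qed.

Lemma normc_le_nat (z : R[i]) n : (`|z| <= n%:R) = (normc z <= n%:R).
Proof. by rewrite normr_normc -(rmorph_nat (real_complex R)) lecR. Qed.

(** The exponent 2 + 2 s of the norm leaves the summable factor
    (weight a)^-2 once the square of the bound is divided out. *)
Lemma s_minus1_of_growth f s :
  (forall a, `|f a| <= (weight a ^ s)%:R) -> f \in @s_minus1 R.
Proof.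
move=> fs; apply/asboolP; exists (2 + s.*2)%N => //.
apply: le_lt_trans (ltry (2 : R)); apply: le_trans esum_words_le.
apply: le_esum => a _; rewrite lee_fin /sqnorm_term.
have w0 : 0 < (weight a)%:R :> R by rewrite ltr0n weight_gt0.
rewrite ler_pdivrMr ?exprn_gt0// exprD.
rewrite mulrA mulVf ?mul1r ?gt_eqF ?exprn_gt0//.
rewrite -muln2 exprM ler_sqr ?nnegrE ?normc_ge0 ?exprn_ge0//.
by rewrite -natrX -normc_le_nat.
Qed.

(** The empty word must be excluded: it has weight 1, so no power of its weight
    absorbs a constant. *)
Lemma growth_of_s_minus1 f : f \in @s_minus1 R ->
  exists s, forall a, a != [::] -> `|f a| <= (weight a ^ s)%:R.
Proof.
move=> /asboolP[r r0 hr].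
have Mge0 : (0 <= sqnorm r f)%E.
  by apply: esum_ge0 => a _; rewrite lee_fin sqnorm_term_ge0.
pose M := fine (sqnorm r f).
have ME : sqnorm r f = M%:E by rewrite fineK// ge0_fin_numE.
have M0 : 0 <= M by rewrite fine_ge0.
have fM a : normc (f a) ^+ 2 <= M * (weight a)%:R ^+ r.
  have w0 : 0 < (weight a)%:R :> R by rewrite ltr0n weight_gt0.
  rewrite -ler_pdivrMr ?exprn_gt0// -lee_fin -ME.
  apply: esum_ge; exists [set a]; first by split; [exact: finite_set1|].
  by rewrite fsbig_set1.
(* M <= k <= 2^k <= (weight a)^k as soon as a is nonempty. *)
pose k := Num.bound M.
exists (k + r)%N => a a0; rewrite normc_le_nat natrX.
have w1 := weight_ge1 R a.
rewrite -ler_sqr ?nnegrE ?normc_ge0 ?exprn_ge0//.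
apply: (le_trans (fM a)); rewrite -exprM mulnC mulnDr exprD.
apply: ler_pM => //.
  have /ltW/le_trans : M < k%:R by exact: archi_boundP.
  apply; rewrite -natrX ler_nat mul2n -addnn.
  have : (k <= 2 ^ k)%N by rewrite ltnW// ltn_expl.
  move/leq_trans; apply; apply: (@leq_trans (weight a ^ k)).
    case: (k) => // k'; rewrite leq_exp2r//.
    apply: leq_trans (weight_ge a); rewrite -[X in (X <= _)%N]expn1 leq_exp2l//.
    by case: a a0 {w1}.
  by rewrite leq_pexp2l ?weight_gt0// leq_addr.
by rewrite ler_weXn2l// leq_pmull.
Qed.

(** * Inversion of series of expectation 1 *)

Lemma ncseries_sumE n (F : 'I_n -> ncseries R) c :
  (\sum_(i < n) F i) c = \sum_(i < n) F i c.
Proof. by elim/big_ind2: _ => // f x g y <- <-. Qed.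

Lemma ncseriesM f g c :
  (f * g) c = \sum_(i < (size c).+1) f (take i c) * g (drop i c).
Proof. by []. Qed.

Section Powers.
Variable h : ncseries R.
Hypothesis h0 : h [::] = 0.

Lemma wick_powS n c : (h ^+ n.+1) c =
  \sum_(i < size c) h (take i.+1 c) * (h ^+ n) (drop i.+1 c).
Proof. by rewrite exprS ncseriesM big_ord_recl take0 h0 mul0r add0r. Qed.

(** Only splittings of c into n nonempty factors contribute to (h^n)_c. *)
Lemma wick_pow_eq0 n c : (size c < n)%N -> (h ^+ n) c = 0.
Proof.
elim: n c => // n IH c; rewrite ltnS => cn; rewrite wick_powS.
apply: big1 => i _; rewrite IH ?mulr0// size_drop.
by apply: leq_trans cn; rewrite -subSn// leq_subLR addSn ltnS leq_addl.
Qed.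

(** The factor 2^|c| bounds the number of splittings of c into nonempty
    factors, each of which contributes at most (weight c)^s. *)
Lemma wick_pow_growth s n c :
  (forall a, a != [::] -> `|h a| <= (weight a ^ s)%:R) ->
  `|(h ^+ n) c| <= (2 ^ size c * weight c ^ s)%:R.
Proof.
move=> hs; have {}hs a : `|h a| <= (weight a ^ s)%:R.
  by have [->|/hs//] := eqVneq a [::]; rewrite h0 normr0.
elim: n c => [|n IH] c.
  rewrite expr0 -[(1 : ncseries R) c]/((c == [::])%:R) normr_nat ler_nat.
  by case: (c == [::]) => //; rewrite muln_gt0 !expn_gt0 weight_gt0.
rewrite wick_powS; apply: (le_trans (ler_norm_sum _ _ _)).
apply: (@le_trans _ _
  (\sum_(i < size c) (2 ^ (size c - i.+1) * weight c ^ s)%:R)).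
  apply: ler_sum => i _; rewrite normrM.
  apply: (le_trans (ler_pM _ _ (hs _) (IH _))) => //.
  by rewrite -natrM size_drop mulnCA -expnMn -weight_cat cat_take_drop.
rewrite -natr_sum -big_distrl/= ler_nat leq_mul2r; apply/orP; right.
(* Reversed, the sum is 1 + 2 + ... + 2^(|c| - 1) = 2^|c| - 1. *)
rewrite (reindex_inj rev_ord_inj)/=.
under eq_bigr do rewrite subnSK// subKn 1?ltnW//.
by rewrite -[X in (X <= _)%N]mul1n -(predn_exp 2) leq_pred.
Qed.
End Powers.

(** The left inverse is the Neumann sum of the powers of h = 1 - f, cut at the
    length of the word, where its further terms vanish.  Of the two extra
    factors weight c in the growth bound, one pays for the number |c| + 1 of
    powers and one for the 2^|c| splittings. *)
Lemma s_minus1_left_inverse (f : S_minus1 R) :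
  gexp f = 1 -> exists g : S_minus1 R, g * f = 1.
Proof.
move=> f1; pose h : ncseries R := 1 - coefs f.
have h0 : h [::] = 0.
  by rewrite /h -[(1 - coefs f) [::]]/(1 - gexp f) f1 subrr.
have [s hs] : exists s, forall a, a != [::] -> `|h a| <= (weight a ^ s)%:R.
  by apply: growth_of_s_minus1; rewrite rpredB ?rpred1 ?coefs_s_minus1.
pose g : ncseries R := fun c => \sum_(n < (size c).+1) (h ^+ n) c.
have gs : g \in @s_minus1 R.
  apply: (@s_minus1_of_growth _ s.+2) => c.
  apply: (le_trans (ler_norm_sum _ _ _)).
  apply: (@le_trans _ _
    (\sum_(n < (size c).+1) (2 ^ size c * weight c ^ s)%:R)).
    by apply: ler_sum => n _; exact: wick_pow_growth.
  rewrite sumr_const card_ord -mulrnA ler_nat.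
  rewrite !expnS [X in (X <= _)%N]mulnC !mulnA leq_mul2r; apply/orP; right.
  apply: leq_mul (weight_ge c); apply: leq_trans (weight_ge c).
  by rewrite ltn_expl.
exists (MkS_minus1 gs); apply: val_inj; apply/funext => c /=.
(* The cut may be moved further, so that all prefixes of c share one. *)
have gE m a : (size a < m)%N -> g a = (\sum_(n < m) h ^+ n) a.
  move=> am; rewrite /g ncseries_sumE.
  rewrite (big_ord_widen_cond m xpredT (fun n => (h ^+ n) a))//.
  rewrite [RHS](bigID (fun n : 'I_m => n < (size a).+1)%N)/=.
  rewrite [X in _ + X]big1 ?addr0//.
  by move=> i; rewrite -leqNgt => /wick_pow_eq0 ->.
have -> : (g * coefs f) c =
    ((\sum_(n < (size c).+1) h ^+ n) * (1 - h)) c.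
  rewrite !ncseriesM; apply: eq_bigr => i _.
  rewrite /h subKr (gE (size c).+1)//.
  by rewrite ltnS size_take_min geq_minr.
rewrite -[_ * _]opprK -mulrN opprB.
rewrite (_ : _ * (h - 1) = h ^+ (size c).+1 - 1).
  rewrite opprB -[LHS]/((1 : ncseries R) c - (h ^+ (size c).+1) c).
  by rewrite wick_pow_eq0// subr0.
rewrite subrX1 mulr_suml mulr_sumr; apply: eq_bigr => i _; apply/esym/commrX.
exact/commr_sym/commrB/commr1.
Qed.
End Growth.

(** * Matrices of expectation 1 *)

Section Expectation.
Variable R : realType.

Let gexpB : {morph @gexp R : f g / f - g}.
Proof. by []. Qed.

Let gexpM : monoid_morphism (@gexp R).
Proof. by split=> // f g; exact: wick_nil. Qed.

HB.instance Definition _ :=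
  GRing.isZmodMorphism.Build (S_minus1 R) R[i] (@gexp R) gexpB.
HB.instance Definition _ :=
  GRing.isMonoidMorphism.Build (S_minus1 R) R[i] (@gexp R) gexpM.

Lemma gexp_const (k : R[i]) : gexp (k%:A : S_minus1 R) = k.
Proof. by rewrite -[LHS]/(k * 1) mulr1. Qed.

(** Induction on the size by block elimination.  The Schur complement
    D - c u b has expectation E[D] - E[c] E[u] E[b] = 1, since E[b] = 0. *)
Lemma left_invertible_of_gexp1 n (M : 'M[S_minus1 R]_n) :
  map_mx (@gexp R) M = 1%:M -> left_invertible M.
Proof.
elim: n M => [|n IH] M M1; first by exists 0; rewrite [LHS]thinmx0 [RHS]thinmx0.
rewrite -[n.+1]/(1 + n)%N in M M1 *.
move: M1; rewrite -[M]submxK map_block_mx scalar_mx_block.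
set a := ulsubmx M; set b := ursubmx M; set c := dlsubmx M; set D := drsubmx M.
move=> /eq_block_mx[a1 b0 c0 D1].
have /s_minus1_left_inverse[u ua] : gexp (a 0 0) = 1.
  by have /matrixP/(_ 0 0) := a1; rewrite !mxE.
have {}ua : u%:M *m a = 1%:M.
  by apply/matrixP => i j; rewrite !ord1 mul_scalar_mx mxE ua mxE.
have [|E ED] := IH (D - c *m u%:M *m b).
  by rewrite map_mxB !map_mxM/= b0 mulmx0 subr0.
(* Read from the right: normalize the corner and clear the first
   column, invert the Schur complement, clear the rest of the first row. *)
exists (block_mx 1%:M (- (u%:M *m b)) 0 1%:M *m block_mx 1%:M 0 0 E *m
   block_mx u%:M 0 (- (c *m u%:M)) 1%:M).
rewrite -!mulmxA mulmx_block !mul0mx !addr0 !mulNmx ua -!mulmxA ua mulmx1.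
rewrite mul1mx addNr mul1mx.
rewrite mulmx_block !mul0mx !mul1mx !mulmx0 !addr0 !add0r.
rewrite [- _ + D]addrC !mulmxA ED.
rewrite mulmx_block !mulmx0 !mulmx1 !mul0mx !mul1mx !addr0 !add0r.
by rewrite subrr -scalar_mx_block.
Qed.
End Expectation.

Theorem theorem5p2 (R : realType) (p N : nat) (hp : (1 <= p)%N) (hN : (1 <= N)%N)
    (C : 'M[S_minus1 R]_(p, N)) (A : 'M[S_minus1 R]_N) :
  observable (map_mx (@gexp R) C) (map_mx (@gexp R) A) -> observable C A.
Proof.
move=> [q q0 [L0 L01]]; exists q => //.
pose L1 : 'M[S_minus1 R]_(N, \sum_(k < q) p) := map_mx (fun k => k%:A) L0.
have [L LM] : left_invertible (L1 *m obs_mx q C A).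
  apply: left_invertible_of_gexp1; rewrite map_mxM -L01; congr (_ *m _).
    by apply/matrixP => i j; rewrite !mxE; exact: gexp_const.
  apply/matrixP => i j; rewrite [LHS]mxE [obs_mx _ _ _ _ _]mxE [RHS]mxE.
  by rewrite -(rmorphXn (map_mx _)) -map_mxM [RHS]mxE.
by exists (L *m L1); rewrite -mulmxA.
Qed.
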